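(* Let $A$ be a commutative unitary ring. The following assertions are equivalent: (i) $A$ is a multiplication ring; (ii) $I\otimes (J:I)=I\cap J$ for every $I,J\in \mathrm{Id}(A)$; (iii) $\big((I\otimes (J:I)):K\big)=\big((I\cap J):K\big)$ for every $I,J,K\in \mathrm{Id}(A)$.
   Context: $\mathrm{Id}(A)$ is the set of ideals of $A$. For ideals $I,J$: $I\otimes J=\{\sum_{k=1}^n i_kj_k : i_k\in I, j_k\in J\}$ is the product ideal and $(J:I)=\{x\in A: xI\subseteq J\}$ is the quotient ideal. An ideal $I$ of $A$ is a multiplication ideal if for every ideal $J\subseteq I$ there exists an ideal $K$ of $A$ such that $J=I\otimes K$. The ring $A$ is a multiplication ring if all its ideals are multiplication ideals. *)

(* Defs.v *)
From mathcomp Require Import all_boot all_order all_algebra.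
From mathcomp Require Import classical_sets.

Set Implicit Arguments.
Unset Strict Implicit.
Unset Printing Implicit Defensive.

Import GRing.Theory.
Local Open Scope classical_set_scope.
Local Open Scope ring_scope.

(* Ideals are Prop-valued subsets, and the whole ring is an ideal, in contrast
   with the boolean, proper ideals of mathcomp's ring_quotient. The zero ring
   is allowed (comPzRingType). *)
Definition is_ideal (A : comPzRingType) (I : set A) : Prop :=
  [/\ I 0,
      forall x y : A, I x -> I y -> I (x + y) &
      forall a x : A, I x -> I (a * x)].

(* The case n = 0 only contributes 0, which is also 0 * 0 when I, J are
   ideals. *)
Definition ideal_prod (A : comPzRingType) (I J : set A) : set A :=
  [set x | exists (n : nat) (i j : 'I_n -> A),
     [/\ forall k, I (i k), forall k, J (j k) &
         x = \sum_(k < n) i k * j k]].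

(* Written (J : I) in the literature; note the order of the arguments. *)
Definition ideal_quot (A : comPzRingType) (J I : set A) : set A :=
  [set x | [set x * i | i in I] `<=` J].

Definition multiplication_ideal (A : comPzRingType) (I : set A) : Prop :=
  is_ideal I /\
  forall J : set A, is_ideal J -> J `<=` I ->
    exists2 K : set A, is_ideal K & J = ideal_prod I K.

Definition multiplication_ring (A : comPzRingType) : Prop :=
  forall I : set A, is_ideal I -> multiplication_ideal I.

Lemma is_ideal_setI (A : comPzRingType) (I J : set A) :
  is_ideal I -> is_ideal J -> is_ideal (I `&` J).
Proof.
move=> [I0 ID IM] [J0 JD JM]; split=> //.
- by move=> x y [Ix Jx] [Iy Jy]; split; [apply: ID | apply: JD].
- by move=> a x [Ix Jx]; split; [apply: IM | apply: JM].
Qed.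

Lemma is_ideal_prod (A : comPzRingType) (I J : set A) :
  is_ideal I -> is_ideal J -> is_ideal (ideal_prod I J).
Proof.
move=> [I0 ID IM] [J0 JD JM]; split.
- by exists 0%N, (fun=> 0), (fun=> 0); split=> //; rewrite big_ord0.
- move=> _ _ [m [i [j [Ii Jj ->]]]] [n [i' [j' [Ii' Jj' ->]]]].
  exists (m + n)%N.
  exists (fun k => match split k with inl u => i u | inr v => i' v end).
  exists (fun k => match split k with inl u => j u | inr v => j' v end).
  split; try by move=> k; case: split.
  rewrite big_split_ord /=; congr (_ + _); apply: eq_bigr => k _.
  + by rewrite (unsplitK (inl k)).
  + by rewrite (unsplitK (inr k)).
- move=> a _ [n [i [j [Ii Jj ->]]]].
  exists n, (fun k => a * i k), j; split=> // [k|]; first exact: IM.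
  by rewrite mulr_sumr; apply: eq_bigr => k _; rewrite mulrA.
Qed.

Lemma is_ideal_quot (A : comPzRingType) (I J : set A) :
  is_ideal I -> is_ideal J -> is_ideal (ideal_quot J I).
Proof.
move=> [I0 ID IM] [J0 JD JM]; split.
- by move=> _ [i _ <-]; rewrite mul0r.
- move=> x y Hx Hy _ [i Ii <-]; rewrite mulrDl.
  by apply: JD; [apply: Hx; exists i | apply: Hy; exists i].
- by move=> a x Hx _ [i Ii <-]; rewrite -mulrA; apply: JM; apply: Hx; exists i.
Qed.

(* Main.v *)
Require Import Defs.
From mathcomp Require Import all_boot all_order all_algebra.
From mathcomp Require Import classical_sets.

(** The product [I (J : I)] is always contained in [I `&` J], so (ii) says that
    this inclusion is an equality.

    If [A] is a multiplication ring, then [I `&` J], being an ideal below [I],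
    equals [I K] for some ideal [K]; since [I K] lies in [J], [K] lies in
    [(J : I)], and monotonicity of the product gives the reverse inclusion
    [setI_sub_prod_quot]. Assertion (iii) is (ii) with [(_ : K)] applied to both
    sides, and nothing is lost because [(J : A) = J] ([ideal_quotT]).
    Finally, when [J `<=` I], the equality in (ii) reads [J = I (J : I)], so
    that [(J : I)] is the cofactor that a multiplication ideal requires. *)

Import GRing.Theory.
Local Open Scope classical_set_scope.
Local Open Scope ring_scope.

Lemma is_ideal_setT (A : comPzRingType) : is_ideal [set: A].
Proof. by []. Qed.

Lemma ideal_sum (A : comPzRingType) (J : set A) (n : nat) (f : 'I_n -> A) :
  is_ideal J -> (forall k, J (f k)) -> J (\sum_(k < n) f k).
Proof. by move=> [J0 JD _] Jf; apply: (big_ind J). Qed.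

Lemma mem_ideal_prod (A : comPzRingType) (I J : set A) (x y : A) :
  I x -> J y -> ideal_prod I J (x * y).
Proof.
move=> Ix Jy; exists 1%N, (fun=> x), (fun=> y); split=> //.
by rewrite big_ord1.
Qed.

Lemma ideal_prodS (A : comPzRingType) (I K L : set A) :
  K `<=` L -> ideal_prod I K `<=` ideal_prod I L.
Proof.
move=> KL _ [n [i [k [Ii Kk ->]]]]; exists n, i, k; split=> // m.
exact: KL.
Qed.

(** Both sides say that every [i * k] with [I i] and [K k] lies in [J]; for the
    product this suffices because [J] is closed under finite sums. This is the
    adjunction between product and quotient, and the only link between them that
    the equivalence of (i) and (ii) rests on. *)
Lemma ideal_prod_sub (A : comPzRingType) (I J K : set A) :
  is_ideal J -> ideal_prod I K `<=` J <-> K `<=` ideal_quot J I.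
Proof.
move=> idJ; split=> [IKJ x Kx _ [i Ii <-] | KJI _ [n [i [k [Ii Kk ->]]]]].
  by rewrite mulrC; apply/IKJ/mem_ideal_prod.
apply: ideal_sum => // m; rewrite mulrC.
by apply: (KJI _ (Kk m)); exists (i m).
Qed.

Lemma ideal_prod_subl (A : comPzRingType) (I K : set A) :
  is_ideal I -> ideal_prod I K `<=` I.
Proof.
move=> idI; have [_ _ IM] := idI; move=> _ [n [i [k [Ii _ ->]]]].
by apply: ideal_sum => // m; rewrite mulrC; apply: IM.
Qed.

Lemma prod_quot_sub_setI (A : comPzRingType) (I J : set A) :
  is_ideal I -> is_ideal J -> ideal_prod I (ideal_quot J I) `<=` I `&` J.
Proof.
move=> idI idJ x Px; split; first exact: ideal_prod_subl Px.
by move: x Px; apply/ideal_prod_sub.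
Qed.

(** Any cofactor [K] of [I `&` J] in [I] is contained in [(J : I)], so the
    latter produces at least as large a product. *)
Lemma setI_sub_prod_quot (A : comPzRingType) (I J : set A) :
  multiplication_ideal I -> is_ideal J ->
  I `&` J `<=` ideal_prod I (ideal_quot J I).
Proof.
move=> [idI multI] idJ.
have [K _ IJE] := multI _ (is_ideal_setI idI idJ) (@subIsetl _ I J).
rewrite IJE; apply/ideal_prodS/ideal_prod_sub => //.
by rewrite -IJE; apply: subIsetr.
Qed.

Lemma ideal_quotT (A : comPzRingType) (J : set A) :
  is_ideal J -> ideal_quot J setT = J.
Proof.
move=> [_ _ JM]; apply/seteqP; split=> [x Jx | x Jx _ [a _ <-]].
  by rewrite -[x]mulr1; apply: Jx; exists 1.
by rewrite mulrC; apply: JM.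
Qed.

Theorem proposition9 (A : comPzRingType) :
  [<-> multiplication_ring A;
       forall I J : set A, is_ideal I -> is_ideal J ->
         ideal_prod I (ideal_quot J I) = I `&` J;
       forall I J K : set A, is_ideal I -> is_ideal J -> is_ideal K ->
         ideal_quot (ideal_prod I (ideal_quot J I)) K
         = ideal_quot (I `&` J) K].
Proof.
tfae.
- move=> multA I J idI idJ; apply/seteqP; split.
    exact: prod_quot_sub_setI.
  exact/setI_sub_prod_quot/idJ/multA.
- by move=> prodE I J K idI idJ _; rewrite prodE.
- move=> quotE I idI; split=> // J idJ JI.
  have idJI := is_ideal_quot idI idJ.
  exists (ideal_quot J I) => //.
  have := quotE I J setT idI idJ (is_ideal_setT A).
  rewrite !ideal_quotT; first by move=> ->; rewrite setIidr.
    exact: is_ideal_setI.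
  exact: is_ideal_prod.
Qed.
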